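(* Let $w\in\mathbb{S}^2$. For $\theta\in(0,1)$ let $u=\theta p'+(1-\theta)p$, where $p'=p'(p,q,w)$ is the post-collisional momentum in center-of-momentum coordinates defined in the context, and let $\frac{\partial u}{\partial p}$ be the Jacobian matrix of $p\mapsto u$ with $q,w,\theta$ held fixed. Then $$\lim_{\theta\to 1}\ \lim_{|q|\to\infty}\ \left|\det\left(\frac{\partial u}{\partial p}\right)\right|_{\text{at } p=0 \text{ and } q=-|q|w}=0.$$
   Context: The speed of light and the rest mass are normalized to $1$. For $p,q\in\mathbb{R}^3$ put $p^0=\sqrt{1+|p|^2}$, $q^0=\sqrt{1+|q|^2}$, $$g=g(p,q)=\sqrt{2(p^0q^0-p\cdot q-1)}\ge 0,\qquad s=s(p,q)=g^2+4=2(p^0q^0-p\cdot q+1),\qquad \gamma=\frac{p^0+q^0}{\sqrt{s}}.$$ One has the identity $\gamma-1=\frac{|p+q|^2}{\sqrt{s}\,(p^0+q^0+\sqrt{s})}$; accordingly, the quotient $\frac{\gamma-1}{|p+q|^2}$ is read as $\frac{1}{\sqrt{s}(p^0+q^0+\sqrt{s})}$. For $w\in\mathbb{S}^2$ (the unit sphere of $\mathbb{R}^3$) the post-collisional momentum in center-of-momentum coordinates is $$p'=\frac{p+q}{2}+\frac{g}{2}\left(w+(\gamma-1)(p+q)\frac{(p+q)\cdot w}{|p+q|^2}\right).$$ In the iterated limit, for each fixed $\theta\in(0,1)$ the derivative is evaluated at $p=0$, $q=-rw$ with $r=|q|>0$, then $r\to\infty$, and finally $\theta\to1$ from below. *)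

(* Defs.v *)
From HB Require Import structures.
From mathcomp Require Import all_boot all_order all_algebra.
From mathcomp Require Import all_classical all_reals all_analysis.
From mathcomp Require Import ring lra.

Set Implicit Arguments.
Unset Strict Implicit.
Unset Printing Implicit Defensive.

Import Order.TTheory GRing.Theory Num.Theory.
Import numFieldNormedType.Exports.

Local Open Scope ring_scope.

Section CenterOfMomentum.
Variable R : realType.
Implicit Types p q w : 'rV[R]_3.

Definition dot p q : R := \sum_(i < 3) p 0 i * q 0 i.

(* The library norm of a row vector is the sup norm. *)
Definition enorm p : R := Num.sqrt (dot p p).

Definition energy p : R := Num.sqrt (1 + enorm p ^+ 2).

Definition rel_momentum p q : R :=
  Num.sqrt (2 * (energy p * energy q - dot p q - 1)).

Definition mandelstam_s p q : R := rel_momentum p q ^+ 2 + 4.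

Definition lorentz_gamma p q : R :=
  (energy p + energy q) / Num.sqrt (mandelstam_s p q).

(* The quotient (gamma - 1) / |p + q|^2, extended to p + q = 0;
   see [lorentz_gamma_sub1]. *)
Definition gamma_quot p q : R :=
  (Num.sqrt (mandelstam_s p q) *
   (energy p + energy q + Num.sqrt (mandelstam_s p q)))^-1.

Definition post_momentum w p q : 'rV[R]_3 :=
  2^-1 *: (p + q) +
  (rel_momentum p q / 2) *: (w + (gamma_quot p q * dot (p + q) w) *: (p + q)).

Definition interp_momentum (theta : R) w q p : 'rV[R]_3 :=
  theta *: post_momentum w p q + (1 - theta) *: p.

Lemma dotE p q : dot p q =
  p 0 0 * q 0 0 + p 0 1 * q 0 1 + p 0 (lift 0 1) * q 0 (lift 0 1).
Proof.
by rewrite /dot !big_ord_recr big_ord0 /= add0r; congr (_ * _ + _ * _ + _ * _);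
  congr (fun_of_matrix _ _ _); apply/val_inj.
Qed.

Lemma dot_ge0 p : 0 <= dot p p.
Proof. by apply: sumr_ge0 => i _; rewrite -expr2 sqr_ge0. Qed.

Lemma enorm_sqr p : enorm p ^+ 2 = dot p p.
Proof. by rewrite /enorm sqr_sqrtr // dot_ge0. Qed.

Lemma energy_sqr p : energy p ^+ 2 = 1 + dot p p.
Proof. by rewrite /energy enorm_sqr sqr_sqrtr // addr_ge0 // dot_ge0. Qed.

Lemma energy_gt0 p : 0 < energy p.
Proof. by rewrite sqrtr_gt0 enorm_sqr ltr_pwDl // dot_ge0. Qed.

Lemma rel_momentum_arg_ge0 p q : 0 <= energy p * energy q - dot p q - 1.
Proof.
have e0 : 0 <= energy p * energy q by rewrite mulr_ge0 // ltW // energy_gt0.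
have [pq0|pq0] := ltP (1 + dot p q) 0; first by lra.
suff: (1 + dot p q) ^+ 2 <= (energy p * energy q) ^+ 2.
  by rewrite ler_sqr ?nnegrE // => ?; lra.
rewrite exprMn !energy_sqr !dotE.
set a := p 0 0; set b := p 0 1; set c := p 0 _.
set x := q 0 0; set y := q 0 1; set z := q 0 _.
have h1 := sqr_ge0 (a - x); have h2 := sqr_ge0 (b - y).
have h3 := sqr_ge0 (c - z); have h4 := sqr_ge0 (a * y - b * x).
have h5 := sqr_ge0 (a * z - c * x); have h6 := sqr_ge0 (b * z - c * y).
by lra.
Qed.

Lemma mandelstam_sE p q :
  mandelstam_s p q = 2 * (energy p * energy q - dot p q + 1).
Proof.
rewrite /mandelstam_s /rel_momentum sqr_sqrtr; last first.
  by rewrite mulr_ge0 // rel_momentum_arg_ge0.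
by ring.
Qed.

Lemma mandelstam_s_gt0 p q : 0 < mandelstam_s p q.
Proof. by rewrite ltr_wpDl // sqr_ge0. Qed.

Lemma lorentz_gamma_sub1 p q :
  lorentz_gamma p q - 1 = gamma_quot p q * enorm (p + q) ^+ 2.
Proof.
have E1 := energy_gt0 p; have E2 := energy_gt0 q.
have S0 := mandelstam_s_gt0 p q.
have r0 : 0 < Num.sqrt (mandelstam_s p q) by rewrite sqrtr_gt0.
have rs : Num.sqrt (mandelstam_s p q) ^+ 2 = mandelstam_s p q.
  by rewrite sqr_sqrtr // ltW.
have -> : enorm (p + q) ^+ 2 =
    (energy p + energy q) ^+ 2 - Num.sqrt (mandelstam_s p q) ^+ 2.
  rewrite rs mandelstam_sE enorm_sqr sqrrD !energy_sqr !dotE !mxE; ring.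
rewrite /lorentz_gamma /gamma_quot; field.
by apply/andP; split; apply: lt0r_neq0; lra.
Qed.

End CenterOfMomentum.

(* Main.v *)
(* At p = 0, q = -r w, everything is symmetric around w, so du/dp has the form
   a I + b w w^T and determinant a^2 (a + b).  Differentiating at this point
   gives a = 1 - theta + theta / sqrt s and a + b = 1.  Since s tends to
   infinity with r, the inner limit is (1 - theta)^2, which vanishes as
   theta -> 1. *)
From HB Require Import structures.
Require Import Defs.
From mathcomp Require Import all_boot all_order all_algebra.
From mathcomp Require Import all_classical all_reals all_analysis.
From mathcomp Require Import ring lra.
Import Order.TTheory GRing.Theory Num.Theory.
Import numFieldNormedType.Exports.
Local Open Scope classical_set_scope.
Local Open Scope ring_scope.

(** * Pointwise differentiation rules *)

(* The library states is_diffD, is_diffM, ... with the operations of function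
   spaces; the pointwise forms below unify with explicit formulas. *)
Lemma is_diff_const {R : realType} {V W : normedModType R} (c : W) (x : V) :
  is_diff x (fun=> c) (fun=> 0).
Proof. exact: is_diff_cst. Qed.

Lemma is_diff_add {R : realType} {V W : normedModType R}
    {f df g dg : V -> W} {x : V} :
  is_diff x f df -> is_diff x g dg ->
  is_diff x (fun y => f y + g y) (fun h => df h + dg h).
Proof. exact: is_diffD. Qed.

Lemma is_diff_mul {R : realType} {V : normedModType R}
    {f df g dg : V -> R} {x : V} :
  is_diff x f df -> is_diff x g dg ->
  is_diff x (fun y => f y * g y) (fun h => f x * dg h + g x * df h).
Proof. exact: is_diffM. Qed.

Lemma is_diff_var {R : realType} {V : normedModType R} (x : V) :
  is_diff x (fun p : V => p) (fun h => h).
Proof. exact: is_diff_id. Qed.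

(** Scaling is a continuous bilinear map [R * W -> W], so the product rule is the chain rule through
    the pair [(k, f)]. *)
Lemma is_diff_scale {R : realType} {V W : normedModType R}
    {k dk : V -> R} {f df : V -> W} {x : V} :
  is_diff x k dk -> is_diff x f df ->
  is_diff x (fun y => k y *: f y) (fun h => dk h *: f x + k x *: df h).
Proof.
move=> kx fx.
have scaleB : bilinear_for (GRing.Scale.Law.clone _ _ *:%R _)
    (GRing.Scale.Law.clone _ _ *:%R _) (@GRing.scale R W).
  split=> [u|u] a y z /=; first by rewrite scalerDl scalerA.
  by rewrite scalerDr !scalerA mulrC.
pose B := bilinear_isBilinear.Build R R W W _ _ (@GRing.scale R W) scaleB.
pose b : {bilinear R -> W -> W} := HB.pack (@GRing.scale R W) B.
have cb : continuous (fun p : R * W => b p.1 p.2) by exact: scale_continuous.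
have db (p : R * W) :
    is_diff p (fun q => b q.1 q.2) (fun q => b p.1 q.2 + b q.1 p.2).
  by split; [exact: differentiable_bilin|exact: diff_bilin].
apply: (is_diff_eq (is_diff_comp (is_diff_pair kx fx) (db (k x, f x)))).
by rewrite funeqE => h /=; rewrite addrC.
Qed.

Lemma is_diff_sqrt {R : realType} {V : normedModType R}
    {f df : V -> R} {x : V} : is_diff x f df -> 0 < f x ->
  is_diff x (fun y => Num.sqrt (f y) : R)
    (fun h => df h / (2 * Num.sqrt (f x))).
Proof.
move=> dfx fx0.
have ds := is_derive1_sqrt fx0.
have dsd : differentiable (Num.sqrt : R -> R) (f x).
  by apply/derivable1_diffP; exact: ex_derive.
apply: (is_diff_eq (is_diff_comp dfx (differentiableP dsd))).
by rewrite funeqE => h /=; rewrite diff1E// derive1E derive_val.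
Qed.

Lemma is_diff_inv {R : realType} {V : normedModType R}
    {f df : V -> R} {x : V} : is_diff x f df -> f x != 0 ->
  is_diff x (fun y => (f y)^-1) (fun h => - (f x) ^- 2 * df h).
Proof.
by move=> dfx fx0; split; [exact: differentiableV|rewrite diffV ?diff_val].
Qed.

Lemma is_diff_coord {R : realType} {n : nat} (i : 'I_n) (x : 'rV[R]_n) :
  is_diff x (fun p : 'rV[R]_n => p 0 i : R) (fun h => h 0 i).
Proof.
have lin : linear (fun p : 'rV[R]_n => p 0 i : R).
  by move=> a u v; rewrite !mxE.
pose M := GRing.isLinear.Build _ _ _ _ _ lin.
pose L : {linear 'rV[R]_n -> R} := HB.pack (fun p : 'rV[R]_n => p 0 i : R) M.
have cL : continuous L by exact: coord_continuous.
by split; [exact: differentiable_coord|exact: (diff_lin _ cL)].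
Qed.

Lemma is_diff_dot {R : realType} {V : normedModType R}
    {f df g dg : V -> 'rV[R]_3} {x : V} :
  is_diff x f df -> is_diff x g dg ->
  is_diff x (fun y => dot (f y) (g y))
    (fun h => dot (df h) (g x) + dot (f x) (dg h)).
Proof.
move=> dfx dgx.
have fi i := is_diff_comp dfx (is_diff_coord i (f x)).
have gi i := is_diff_comp dgx (is_diff_coord i (g x)).
have -> : (fun y => dot (f y) (g y)) = (fun y => f y 0 0 * g y 0 0 +
    f y 0 1 * g y 0 1 + f y 0 (lift 0 1) * g y 0 (lift 0 1)).
  by rewrite funeqE => y; rewrite dotE.
apply: (is_diff_eq (is_diff_add (is_diff_add (is_diff_mul (fi _) (gi _))
  (is_diff_mul (fi _) (gi _))) (is_diff_mul (fi _) (gi _)))).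
by rewrite funeqE => h; rewrite !dotE /=; ring.
Qed.

(** * First-order expansions at p = 0 *)

Lemma dot0l {R : realType} (p : 'rV[R]_3) : dot 0 p = 0.
Proof. by rewrite dotE !mxE; ring. Qed.

Lemma dot0r {R : realType} (p : 'rV[R]_3) : dot p 0 = 0.
Proof. by rewrite dotE !mxE; ring. Qed.

Lemma energy0 (R : realType) : energy (0 : 'rV[R]_3) = 1.
Proof. by rewrite /energy enorm_sqr dot0l addr0 sqrtr1. Qed.

(** The gradient [p / energy p] vanishes at the origin, so in what follows the energy of [p] acts as
    a constant to first order. *)
Lemma is_diff_energy0 (R : realType) :
  is_diff (0 : 'rV[R]_3) (@energy R) (fun=> 0).
Proof.
have -> : @energy R = fun p => Num.sqrt (1 + dot p p).
  by rewrite funeqE => p; rewrite /energy enorm_sqr.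
have v := is_diff_var (0 : 'rV[R]_3).
have p1 : 0 < 1 + dot 0 0 :> R by rewrite ltr_pwDl// dot_ge0.
have k := is_diff_const (1 : R) (0 : 'rV[R]_3).
apply: (is_diff_eq (is_diff_sqrt (is_diff_add k (is_diff_dot v v)) p1)).
by rewrite funeqE => h; rewrite dot0l dot0r !addr0 mul0r.
Qed.

(** Serves both invariants: [c = -1] gives g^2 and [c = 1] gives s. *)
Lemma is_diff_energy_dot0 {R : realType} (c : R) (q : 'rV[R]_3) :
  is_diff (0 : 'rV[R]_3) (fun p => 2 * (energy p * energy q - dot p q + c))
    (fun h => - 2 * dot h q).
Proof.
have v := is_diff_var (0 : 'rV[R]_3).
have k (a : R) := is_diff_const a (0 : 'rV[R]_3).
have dE := is_diff_mul (is_diff_energy0 R) (k (energy q)).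
have dd := is_diff_mul (k (- 1)) (is_diff_dot v (is_diff_const q _)).
have -> : (fun p => 2 * (energy p * energy q - dot p q + c)) =
    (fun p => 2 * (energy p * energy q + -1 * dot p q + c)).
  by rewrite funeqE => p; rewrite mulN1r.
apply: (is_diff_eq (is_diff_mul (k 2)
  (is_diff_add (is_diff_add dE dd) (k c)))).
by rewrite funeqE => h; rewrite !dot0r; ring.
Qed.

Lemma is_diff_rel_momentum0 {R : realType} (q : 'rV[R]_3) :
  0 < rel_momentum 0 q ->
  is_diff (0 : 'rV[R]_3) (fun p => rel_momentum p q)
    (fun h => - dot h q / rel_momentum 0 q).
Proof.
rewrite sqrtr_gt0 => g0.
apply: (is_diff_eq (is_diff_sqrt (is_diff_energy_dot0 (- 1) q) g0)).
rewrite funeqE => h; rewrite /rel_momentum -sqrtr_gt0 in g0 *.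
by field; rewrite lt0r_neq0.
Qed.

Lemma is_diff_sqrt_mandelstam0 {R : realType} (q : 'rV[R]_3) :
  is_diff (0 : 'rV[R]_3) (fun p => Num.sqrt (mandelstam_s p q) : R)
    (fun h => - dot h q / Num.sqrt (mandelstam_s 0 q)).
Proof.
have s0 := mandelstam_s_gt0 0 q.
have sE : (fun p => mandelstam_s p q) =
    fun p => 2 * (energy p * energy q - dot p q + 1).
  by rewrite funeqE => p; rewrite mandelstam_sE.
have ds : is_diff (0 : 'rV[R]_3) (fun p => mandelstam_s p q)
    (fun h => - 2 * dot h q).
  by rewrite sE; exact: is_diff_energy_dot0.
apply: (is_diff_eq (is_diff_sqrt ds s0)).
by rewrite funeqE => h; field; rewrite lt0r_neq0// sqrtr_gt0.
Qed.

(** The denominator varies only through sigma = sqrt s: its differential is (1 + [energy q] + 2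
    sigma) d sigma, with d sigma = - [dot h q] / sigma. *)
Lemma is_diff_gamma_quot0 {R : realType} (q : 'rV[R]_3) :
  let sigma := Num.sqrt (mandelstam_s 0 q) in
  is_diff (0 : 'rV[R]_3) (fun p => gamma_quot p q)
    (fun h => gamma_quot 0 q ^+ 2 * (2 + (1 + energy q) / sigma) * dot h q).
Proof.
move=> sigma.
have sg0 : 0 < sigma by rewrite sqrtr_gt0 mandelstam_s_gt0.
have E0 := energy_gt0 q.
have ds := is_diff_sqrt_mandelstam0 q.
have den0 : sigma * (energy 0 + energy q + sigma) != 0.
  by rewrite energy0 lt0r_neq0// mulr_gt0//; lra.
have kE := is_diff_const (energy q) (0 : 'rV[R]_3).
have dE := is_diff_add (is_diff_energy0 R) kE.
apply: (is_diff_eq (is_diff_inv (is_diff_mul ds (is_diff_add dE ds)) den0)).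
rewrite funeqE => h; rewrite /gamma_quot -/sigma energy0; field.
by rewrite !lt0r_neq0//; lra.
Qed.

(** The three terms come from varying, in order, the vectors [p] and [p + q], the factor g, and the
    scalar [gamma_quot p q * dot (p + q) w]. *)
Lemma is_diff_interp_momentum0 {R : realType} (theta : R) (w q : 'rV[R]_3) :
  0 < rel_momentum 0 q ->
  let g := rel_momentum 0 q in
  let sigma := Num.sqrt (mandelstam_s 0 q) in
  let kappa := gamma_quot 0 q in
  is_diff (0 : 'rV[R]_3) (interp_momentum theta w q)
    (fun h => (1 - theta / 2 + theta * g / 2 * kappa * dot q w) *: h -
      (theta * dot h q / (2 * g)) *: (w + (kappa * dot q w) *: q) +
      (theta * g / 2 * (kappa ^+ 2 * (2 + (1 + energy q) / sigma) * dot h q *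
        dot q w + kappa * dot h w)) *: q).
Proof.
move=> g0 g sigma kappa.
have v := is_diff_var (0 : 'rV[R]_3).
have k (a : R) := is_diff_const a (0 : 'rV[R]_3).
have kv (u : 'rV[R]_3) := is_diff_const u (0 : 'rV[R]_3).
have dpq := is_diff_add v (kv q).
have dg := is_diff_mul (is_diff_rel_momentum0 q g0) (k 2^-1).
have dc := is_diff_mul (is_diff_gamma_quot0 q) (is_diff_dot dpq (kv w)).
have dpost := is_diff_add (is_diff_scale (k 2^-1) dpq)
  (is_diff_scale dg (is_diff_add (kv w) (is_diff_scale dc dpq))).
apply: (is_diff_eq (is_diff_add (is_diff_scale (k theta) dpost)
  (is_diff_scale (k (1 - theta)) v))).
rewrite funeqE => h; rewrite !add0r !dot0r !addr0 -/g -/sigma -/kappa.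
apply/rowP => i; rewrite !mxE; field.
by rewrite !lt0r_neq0// sqrtr_gt0 mandelstam_s_gt0.
Qed.

(** * The derivative at q = -r w *)

Lemma dotZl {R : realType} (a : R) (p q : 'rV[R]_3) :
  dot (a *: p) q = a * dot p q.
Proof. by rewrite !dotE !mxE; ring. Qed.

Lemma dotZr {R : realType} (a : R) (p q : 'rV[R]_3) :
  dot p (a *: q) = a * dot p q.
Proof. by rewrite !dotE !mxE; ring. Qed.

(* With sigma = sqrt s and kappa = gamma_quot, the point satisfies
   g sigma = 2 r and kappa r^2 = gamma - 1 = (sigma - 2) / 2, which collapses
   the derivative to the two coefficients below; they sum to 1. *)
Lemma is_diff_interp_momentum_antiparallel {R : realType} (theta r : R)
    (w : 'rV[R]_3) : dot w w = 1 -> 0 < r ->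
  let sigma := Num.sqrt (mandelstam_s 0 (- r *: w)) in
  is_diff (0 : 'rV[R]_3) (interp_momentum theta w (- r *: w))
    (fun h => (1 - theta + theta / sigma) *: h +
      (theta * (1 - sigma^-1) * dot h w) *: w).
Proof.
move=> w1 r0 sigma; set q := - r *: w.
have qq : dot q q = r ^+ 2 by rewrite dotZl dotZr w1; ring.
have E2 := energy_sqr q; rewrite qq in E2.
have E0 := energy_gt0 q.
have E1 : 1 < energy q.
  by rewrite -(@ltr_pXn2r _ 2) ?nnegrE ?ltW// E2 expr1n ltrDl exprn_gt0.
have g2 : rel_momentum 0 q ^+ 2 = 2 * (energy q - 1).
  by rewrite sqr_sqrtr energy0 dot0l mul1r subr0//; lra.
have s2 : sigma ^+ 2 = 2 * (energy q + 1).
  rewrite sqr_sqrtr ?(ltW (mandelstam_s_gt0 _ _))//.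
  by rewrite mandelstam_sE energy0 dot0l; ring.
have sg0 : 0 < sigma by rewrite sqrtr_gt0 mandelstam_s_gt0.
have g0 : 0 < rel_momentum 0 q.
  by rewrite sqrtr_gt0 energy0 dot0l mul1r subr0; lra.
(* Compare squares: g^2 s = 4 (E^2 - 1) = 4 r^2, where E = [energy q]. *)
have gs : rel_momentum 0 q * sigma = 2 * r.
  apply/eqP; rewrite -(@eqrXn2 _ 2)//; last 2 first.
  - by rewrite mulr_ge0// ltW.
  - by rewrite mulr_ge0// ltW.
  by apply/eqP; rewrite !exprMn g2 s2; lra.
(* Since E = sigma^2 / 2 - 1, the factor 1 + E + sigma equals sigma (sigma + 2) / 2. *)
have kE : gamma_quot 0 q = 2 / (sigma ^+ 2 * (sigma + 2)).
  rewrite /gamma_quot -/sigma energy0.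
  have -> : energy q = sigma ^+ 2 / 2 - 1 by rewrite s2; field.
  by field; apply/and3P; split; apply: lt0r_neq0; nra.
have rg : r / rel_momentum 0 q = sigma / 2.
  by rewrite (_ : r = rel_momentum 0 q * sigma / 2);
    [field; rewrite lt0r_neq0|rewrite gs; field].
have gr : rel_momentum 0 q * r = (sigma ^+ 2 - 4) * sigma / 2.
  have -> : sigma ^+ 2 - 4 = rel_momentum 0 q ^+ 2 by rewrite g2 s2; ring.
  by rewrite expr2 -[_ * _ * sigma]mulrA gs; field.
have r2 : r ^+ 2 = (sigma ^+ 2 - 4) * sigma ^+ 2 / 4.
  have -> : r = rel_momentum 0 q * sigma / 2 by rewrite gs; field.
  have -> : sigma ^+ 2 - 4 = rel_momentum 0 q ^+ 2 by rewrite g2 s2; ring.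
  by field.
have gkr : rel_momentum 0 q * gamma_quot 0 q * r = (sigma - 2) / sigma.
  by rewrite mulrAC gr kE; field; rewrite !lt0r_neq0//; lra.
have kr2 : gamma_quot 0 q * r ^+ 2 = (sigma - 2) / 2.
  by rewrite r2 kE; field; rewrite !lt0r_neq0//; lra.
have es : (1 + energy q) / sigma = sigma / 2.
  have -> : 1 + energy q = sigma ^+ 2 / 2 by rewrite s2; field.
  by field; rewrite lt0r_neq0.
apply: (is_diff_eq (is_diff_interp_momentum0 theta w q g0)).
rewrite funeqE => h; apply/rowP => i; rewrite -/sigma es /q dotZl dotZr w1 -/q.
rewrite !mxE mulr1.
(* From here g and kappa enter only through r / g, g kappa r and kappa r^2, all rational in
   sigma. *)
move: (rel_momentum 0 q) (gamma_quot 0 q) g0 rg gkr kr2 => g k g0 rg gkr kr2.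
have -> : 1 - theta / 2 + theta * g / 2 * k * - r =
    1 - theta / 2 - theta / 2 * (g * k * r) by ring.
rewrite -addrA; congr (_ * _ + _).
  by rewrite gkr; field; rewrite lt0r_neq0.
(* Coefficient of [w]: the first product stems from the variation of g, the second from that of
   kappa (p + q) . w. *)
transitivity (theta / 2 * ((r / g) * (1 + k * r ^+ 2) -
    (g * k * r) * (k * r ^+ 2 * (2 + sigma / 2) + 1)) * dot h w * w 0 i).
  by field; rewrite lt0r_neq0.
by rewrite rg gkr kr2; field; rewrite lt0r_neq0.
Qed.

(** * The Jacobian determinant *)

(* Both sides are the determinant of the block matrix [1, A; B, 1], eliminated
   from either corner. *)
Lemma det_1Bmulmx {R : comNzRingType} {m n : nat}
    (A : 'M[R]_(m, n)) (B : 'M[R]_(n, m)) :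
  \det (1%:M - A *m B) = \det (1%:M - B *m A).
Proof.
have L : block_mx 1%:M A B 1%:M =
    block_mx 1%:M 0 B 1%:M *m block_mx 1%:M A 0 (1%:M - B *m A).
  by rewrite mulmx_block !mul1mx !mul0mx !mulmx1 !addr0 addrC subrK.
have U : block_mx 1%:M A B 1%:M =
    block_mx 1%:M A 0 1%:M *m block_mx (1%:M - A *m B) 0 B 1%:M.
  by rewrite mulmx_block !mul1mx !mul0mx !mulmx1 ?mulmx0 !add0r subrK.
have := congr1 determinant L.
by rewrite U !det_mulmx !det_ublock !det_lblock !det1 !mul1r !mulr1.
Qed.

(** After factoring out [a], [det_1Bmulmx] reduces the rank-one perturbation of the identity to a 1
    x 1 determinant. *)
Lemma det_scalar_add_rank1 {F : fieldType} {n : nat} (a b : F)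
    (w : 'rV[F]_n.+1) : a != 0 ->
  \det (a%:M + b *: (w^T *m w)) = a ^+ n * (a + b * (w *m w^T) 0 0).
Proof.
move=> a0.
have -> : a%:M + b *: (w^T *m w) = a *: (1%:M - (- (b / a) *: w^T) *m w).
  rewrite -scalemxAl scaleNr opprK scalerDr scalemx1 scalerA.
  by rewrite mulrCA divff// mulr1.
rewrite detZ det_1Bmulmx det_mx11 -scalemxAr.
set v := w *m w^T.
by rewrite mxE [1%:M 0 0]mxE mxE [(_ *: v) 0 0]mxE eqxx mulr1n exprS; field.
Qed.

Lemma dotE_mulmx {R : realType} (p q : 'rV[R]_3) : dot p q = (p *m q^T) 0 0.
Proof. by rewrite mxE; apply: eq_bigr => i _; rewrite mxE. Qed.

Lemma det_jacobian_interp_momentum {R : realType} (theta r : R)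
    (w : 'rV[R]_3) : dot w w = 1 -> 0 < theta < 1 -> 0 < r ->
  \det ('J (interp_momentum theta w (- r *: w)) 0) =
  (1 - theta + theta / Num.sqrt (mandelstam_s 0 (- r *: w))) ^+ 2.
Proof.
move=> w1 /andP[t0 t1] r0.
have D := is_diff_interp_momentum_antiparallel theta r w w1 r0.
set sigma := Num.sqrt _ in D *.
have sg0 : 0 < sigma by rewrite sqrtr_gt0 mandelstam_s_gt0.
have a0 : 0 < 1 - theta + theta / sigma.
  by rewrite ltr_wpDr ?subr_gt0// divr_ge0// ltW.
set f := interp_momentum _ _ _ in D *.
have -> : 'J f 0 = (1 - theta + theta / sigma)%:M +
    (theta * (1 - sigma^-1)) *: (w^T *m w).
  (* Row [i] of the Jacobian is the differential at the [i]-th basis vector, whose dot product with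
     [w] is [w 0 i]. *)
  apply/matrixP => i j; rewrite mxE diff_val !mxE big_ord1 !mxE eqxx /=.
  rewrite [dot _ _]/dot (bigD1 i)//= big1 ?addr0 => [|k ki]; last first.
    by rewrite mxE (negPf ki) andbF mul0r.
  by rewrite mxE !eqxx mul1r mulr_natr eq_sym -mulrA.
rewrite det_scalar_add_rank1 ?lt0r_neq0// -dotE_mulmx w1.
by rewrite (_ : _ + _ * 1 = 1) ?mulr1//; field; rewrite lt0r_neq0.
Qed.

(** * The two limits *)

(** Since s = 2 ([energy q] + 1) and [energy q >= r], sqrt s exceeds [A > 0] as soon as
    [r >= A ^+ 2]. *)
Lemma cvg_sqrt_mandelstam0 {R : realType} (w : 'rV[R]_3) : dot w w = 1 ->
  Num.sqrt (mandelstam_s 0 (- r *: w)) @[r --> +oo] --> +oo.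
Proof.
move=> w1; apply/cvgryPge => A; near=> r.
have [A0|A0] := leP A 0; first exact: le_trans (sqrtr_ge0 _).
have r0 : 0 <= r by near: r; exact: nbhs_pinfty_ge.
rewrite -[A](gtr0_norm A0) -sqrtr_sqr; apply: ler_wsqrtr.
rewrite mandelstam_sE energy0 dot0l mul1r subr0.
have Ar : A ^+ 2 <= r by near: r; exact: nbhs_pinfty_ge (num_real _).
have rE : r <= energy (- r *: w).
  rewrite -(@ler_pXn2r _ 2) ?nnegrE ?ltW ?energy_gt0//.
  by rewrite energy_sqr dotZl dotZr w1; lra.
by lra.
Unshelve. all: by end_near. Qed.

(* The library Jacobian acts on row vectors, so it is the transpose of the
   matrix of entries du_i/dp_j.  It has a default value at points of
   non-differentiability, whence the first conjunct. *)
Theorem theorem3p1 (R : realType) (w : 'rV[R]_3) (hw : enorm w = 1) :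
  (forall theta r : R, 0 < theta < 1 -> 0 < r ->
     differentiable (interp_momentum theta w (- r *: w)) (0 : 'rV[R]_3)) /\
  exists l : R -> R,
    (forall theta : R, 0 < theta < 1 ->
       `| \det ('J (interp_momentum theta w (- r *: w)) 0)^T | @[r --> +oo]
         --> l theta) /\
    l theta @[theta --> 1^'-] --> (0 : R).
Proof.
have w1 : dot w w = 1 by rewrite -enorm_sqr hw expr1n.
split=> [theta r _ r0|].
  exact: (@ex_diff _ _ _ _ _ _ _
    (is_diff_interp_momentum_antiparallel theta r w w1 r0)).
exists (fun theta => (1 - theta) ^+ 2); split=> [theta t01|].
  have : (1 - theta + theta * (Num.sqrt (mandelstam_s 0 (- r *: w)))^-1) ^+ 2
      @[r --> +oo] --> (1 - theta + theta * 0) ^+ 2.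
    apply: cvgM; (apply: cvgD; [exact: cvg_cst|apply: cvgMl_tmp]);
    (apply/gtr0_cvgV0; [|exact: cvg_sqrt_mandelstam0]);
    by apply: nearW => r; rewrite sqrtr_gt0 mandelstam_s_gt0.
  (* The determinant formula holds for [r > 0], hence eventually, which suffices for the limit. *)
  rewrite mulr0 addr0; apply: cvg_trans; apply: near_eq_cvg; near=> r.
  have r0 : 0 < r by near: r; exact: nbhs_pinfty_gt.
  by rewrite det_tr det_jacobian_interp_momentum// ger0_norm// sqr_ge0.
(* The left limit follows from continuity of [(1 - theta) ^+ 2] at 1. *)
apply: cvg_at_left_filter.
have {1}-> : (0 : R) = (1 - 1) ^+ 2 by rewrite subrr expr0n.
by apply: cvgM; (apply: cvgB; [exact: cvg_cst|exact: cvg_id]).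
Unshelve. all: by end_near. Qed.
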